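(* Let $q$ be a prime number. Then the quasivariety $\mathcal{Q}(\mathbf{ŁV}_{q+1}\times\mathbf{ŁV}_2)$ is axiomatized by the axioms of MV-algebras, together with an identity (in one variable) axiomatizing the variety $\mathcal{V}(\mathbf{ŁV}_{q+1})$ relative to MV-algebras, together with the quasi-identity $$q(x\wedge\neg x)\approx1\ \Rightarrow\ y\vee\neg y\approx1.$$
   Context: MV-algebras are algebras $(A,\oplus,\neg,0)$ (with $1=\neg0$); $\mathbf{ŁV}_{n+1}$ is the MV-chain on $\{0,\frac1n,\dots,1\}$ with $\neg x=1-x$, $x\oplus y=\min\{1,x+y\}$; $x\vee y=\max$, $x\wedge y=\min$ in these chains (in general $x\vee y=\neg(\neg x\oplus y)\oplus y$, $x\wedge y=\neg(\neg x\vee\neg y)$). $qz$ denotes $z\oplus\cdots\oplus z$ ($q$ times). $\mathcal{Q}(K)$ and $\mathcal{V}(K)$ denote the quasivariety and the variety generated by $K$. *)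

(* Defs.v *)
From mathcomp Require Import all_boot.
From Stdlib Require List.
Set Implicit Arguments. Unset Strict Implicit. Unset Printing Implicit Defensive.

Record algebra := Algebra {
  carrier :> Type;
  op_oplus : carrier -> carrier -> carrier;
  op_neg : carrier -> carrier;
  op_zero : carrier }.

Definition is_MV (A : algebra) : Prop :=
  let o := @op_oplus A in let n := @op_neg A in let z := @op_zero A in
  (forall x y w : carrier A, o x (o y w) = o (o x y) w) /\
  (forall x y : carrier A, o x y = o y x) /\
  (forall x : carrier A, o x z = x) /\
  (forall x : carrier A, n (n x) = x) /\
  (forall x : carrier A, o x (n z) = n z) /\
  (forall x y : carrier A, o (n (o (n x) y)) y = o (n (o (n y) x)) x).

Inductive term : Type :=
| Var : nat -> term
| Zero : term
| Neg : term -> term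
| Oplus : term -> term -> term.

Fixpoint eval (A : algebra) (v : nat -> carrier A) (t : term) : carrier A :=
  match t with
  | Var i => v i
  | Zero => @op_zero A
  | Neg s => @op_neg A (eval v s)
  | Oplus s u => @op_oplus A (eval v s) (eval v u)
  end.

Definition One : term := Neg Zero.
Definition Join (s t : term) : term := Oplus (Neg (Oplus (Neg s) t)) t.
Definition Meet (s t : term) : term := Neg (Join (Neg s) (Neg t)).
Fixpoint nmul (k : nat) (t : term) : term :=
  match k with
  | 0 => Zero
  | 1 => t
  | S k' => Oplus (nmul k' t) t
  end.

Definition equation := (term * term)%type.
Definition quasi_identity := (list equation * equation)%type.

Definition sat_eq (A : algebra) (e : equation) : Prop :=
  forall v : nat -> carrier A, eval v e.1 = eval v e.2.

Definition sat_qeq (A : algebra) (Q : quasi_identity) : Prop :=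
  forall v : nat -> carrier A,
    (forall e, List.In e Q.1 -> eval v e.1 = eval v e.2) ->
    eval v Q.2.1 = eval v Q.2.2.

Definition in_Q (B A : algebra) : Prop :=
  forall Q : quasi_identity, sat_qeq B Q -> sat_qeq A Q.

Definition in_V (B A : algebra) : Prop :=
  forall e : equation, sat_eq B e -> sat_eq A e.

Fixpoint only_var (k : nat) (t : term) : bool :=
  match t with
  | Var i => i == k
  | Zero => true
  | Neg s => only_var k s
  | Oplus s u => only_var k s && only_var k u
  end.

Definition one_var (e : equation) : Prop :=
  exists k, only_var k e.1 && only_var k e.2.

Definition axiomatizes_V_rel_MV (e : equation) (B : algebra) : Prop :=
  forall A : algebra, is_MV A -> (in_V B A <-> sat_eq A e).

(** The MV-chain LV_{n+1} on {0, 1/n, ..., 1}, element i/n coded as i : 'I_n.+1. *)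
Definition LV (n : nat) : algebra :=
  @Algebra 'I_n.+1
    (fun i j => inord (minn n (i + j)))
    (fun i => inord (n - i))
    (inord 0).

Definition prod_alg (A B : algebra) : algebra :=
  @Algebra (A * B)%type
    (fun x y => (@op_oplus A x.1 y.1, @op_oplus B x.2 y.2))
    (fun x => (@op_neg A x.1, @op_neg B x.2))
    (@op_zero A, @op_zero B).

Definition qi_q (q : nat) : quasi_identity :=
  ([:: (nmul q (Meet (Var 0) (Neg (Var 0))), One)],
   (Join (Var 1) (Neg (Var 1)), One)).

(* Main.v *)
Require Import Defs.
From mathcomp Require Import all_boot zify.
From mathcomp Require Import boolp classical_sets.
Set Implicit Arguments. Unset Strict Implicit. Unset Printing Implicit Defensive.

(** Every MV-algebra is a subdirect product of chains. For 0 < i < q let g_i be a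
    unary term taking the value 1/q at i/q; it exists because q is prime. The
    identity saying that x = 0, or x = 1, or, for some i, (q - 1) g_i(x) = ¬ g_i(x)
    and i g_i(x) = x forces an MV-chain to be an image of ŁV_{q+1} or ŁV_2, the g
    with (q - 1) g = ¬ g being unique in a chain.

    Let A satisfy the identities of ŁV_{q+1} and the quasi-identity, and let a
    quasi-identity P ⇒ c hold in the product, its premises being gathered in one
    term p. If P has a Boolean solution, then P ⇒ c holds in ŁV_{q+1}, so that
    q(¬p) ⊕ c = 1 is an identity of ŁV_{q+1}. If not, take for z the join of the
    x_i ∧ ¬x_i: then q(¬p) ⊕ q(z ∧ ¬z) = 1 is an identity of ŁV_{q+1}, so a solution
    of P in A gives q(z ∧ ¬z) = 1, hence y ∨ ¬y = 1 for all y; the case y = z turns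
    this into 0 = 1. *)

(** * Arithmetic and order of MV-algebras *)

Local Notation "x ⊕ y" := (op_oplus x y) (at level 50, left associativity).
Local Notation "¬ x" := (op_neg x) (at level 35, right associativity).
Local Notation "⊥" := (op_zero _).
Local Notation "⊤" := (op_neg (op_zero _)).
Local Notation "x ⇒ y" := (¬ x ⊕ y) (at level 55, right associativity).
Local Notation "x ⊙ y" := (¬ (¬ x ⊕ ¬ y)) (at level 45, left associativity).
Local Notation "x ⊔ y" := (¬ (¬ x ⊕ y) ⊕ y) (at level 52, left associativity).
Local Notation "x ⊑ y" := (¬ x ⊕ y = ⊤) (at level 70).

Fixpoint amul (A : algebra) (k : nat) (x : A) : A :=
  if k is k'.+1 then amul k' x ⊕ x else ⊥.

Section MVTheory.
Variable A : algebra.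
Hypothesis MV : is_MV A.
Implicit Types x y s w a b : A.

Lemma oplusA x y w : x ⊕ (y ⊕ w) = x ⊕ y ⊕ w. Proof. by case: MV. Qed.
Lemma oplusC x y : x ⊕ y = y ⊕ x. Proof. by case: MV => _ []. Qed.
Lemma oplusx0 x : x ⊕ ⊥ = x. Proof. by case: MV => _ [_ []]. Qed.
Lemma negK x : ¬ ¬ x = x. Proof. by case: MV => _ [_ [_ []]]. Qed.
Lemma oplusx1 x : x ⊕ ⊤ = ⊤. Proof. by case: MV => _ [_ [_ [_ []]]]. Qed.
Lemma joinC x y : x ⊔ y = y ⊔ x. Proof. by case: MV => _ [_ [_ [_ []]]]. Qed.

Lemma oplus0x x : ⊥ ⊕ x = x. Proof. by rewrite oplusC oplusx0. Qed.
Lemma oplus1x x : ⊤ ⊕ x = ⊤. Proof. by rewrite oplusC oplusx1. Qed.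

Lemma le_refl x : x ⊑ x.
Proof. by have := joinC x ⊤; rewrite oplusx1 negK oplus0x => ->. Qed.

Lemma join_idPr x y : x ⊑ y -> x ⊔ y = y.
Proof. by move=> ->; rewrite negK oplus0x. Qed.

Lemma le_anti x y : x ⊑ y -> y ⊑ x -> x = y.
Proof. by move=> /join_idPr xy /join_idPr yx; rewrite -yx joinC. Qed.

Lemma le_oplusl x w : x ⊑ x ⊕ w.
Proof. by rewrite oplusA le_refl oplus1x. Qed.

Lemma le_oplusr x w : x ⊑ w ⊕ x.
Proof. by rewrite (oplusC w); apply: le_oplusl. Qed.

(** The witness is the difference y ⊖ x = ¬(¬y ⊕ x): adding x to it gives the join of x and y. *)
Lemma le_witness x y : x ⊑ y -> exists w, y = x ⊕ w.
Proof.
move=> /join_idPr xy; exists (¬ (¬ y ⊕ x)).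
by rewrite oplusC joinC.
Qed.

Lemma le_trans y x w : x ⊑ y -> y ⊑ w -> x ⊑ w.
Proof.
by move=> /le_witness[a ->] /le_witness[b ->]; rewrite -!oplusA le_oplusl.
Qed.

Lemma le_oplus2r w x y : x ⊑ y -> x ⊕ w ⊑ y ⊕ w.
Proof.
move=> /le_witness[a ->].
by rewrite -(oplusA x) (oplusC a) (oplusA x) le_oplusl.
Qed.

Lemma le_oplus2l w x y : x ⊑ y -> w ⊕ x ⊑ w ⊕ y.
Proof. by rewrite !(oplusC w); apply: le_oplus2r. Qed.

Lemma contrapositive x y : ¬ y ⇒ ¬ x = x ⇒ y.
Proof. by rewrite negK oplusC. Qed.

Lemma le_neg x y : x ⊑ y -> ¬ y ⊑ ¬ x.
Proof. by rewrite contrapositive. Qed.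

Lemma le0x x : ⊥ ⊑ x. Proof. exact: oplus1x. Qed.

Lemma lex0 x : x ⊑ ⊥ -> x = ⊥.
Proof. by move=> x0; apply: (le_anti x0); apply: le0x. Qed.

Lemma le1x x : ⊤ ⊑ x -> x = ⊤.
Proof. by rewrite negK oplus0x. Qed.

Lemma imp1x x : ⊤ ⇒ x = x. Proof. by rewrite negK oplus0x. Qed.

Lemma residuation x y w : x ⊙ y ⇒ w = x ⇒ (y ⇒ w).
Proof. by rewrite negK oplusA. Qed.

Lemma odotC x y : x ⊙ y = y ⊙ x. Proof. by rewrite oplusC. Qed.

Lemma le_odotl x y : x ⊙ y ⊑ x.
Proof. by rewrite -{2}(negK x); apply: le_neg; apply: le_oplusl. Qed.

Lemma le_joinr x y : y ⊑ x ⊔ y. Proof. exact: le_oplusr. Qed.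

Lemma le_joinl x y : x ⊑ x ⊔ y. Proof. rewrite joinC; apply: le_joinr. Qed.

(** As y ⊑ w, w equals w ⊔ y, and joining with y is monotone because its two negations cancel. *)
Lemma join_lub x y w : x ⊑ w -> y ⊑ w -> x ⊔ y ⊑ w.
Proof.
move=> xw /join_idPr yw; rewrite -yw (joinC y).
by apply/le_oplus2r/le_neg/le_oplus2r/le_neg.
Qed.

Lemma odot_eq1 x y : x ⊙ y = ⊤ <-> x = ⊤ /\ y = ⊤.
Proof.
split=> [xy|[-> ->]]; last by rewrite !negK oplusx0.
by split; apply: le1x; [rewrite -{1}xy|rewrite -{1}xy odotC]; apply: le_odotl.
Qed.

Lemma equiv_eq1 x y : (x ⇒ y) ⊙ (y ⇒ x) = ⊤ <-> x = y.
Proof.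
rewrite odot_eq1; split=> [[]|->]; first exact: le_anti.
by rewrite le_refl.
Qed.

(** The right side is y ⊕ (¬x ⊔ w), which lies above y ⊕ ¬x. This makes ⊕ compatible with the
    congruence of a filter. *)
Lemma imp_oplus2r x y w : x ⇒ y ⊑ (x ⊕ w) ⇒ (y ⊕ w).
Proof.
have xJ : ¬ x ⊑ ¬ (x ⊕ w) ⊕ w by rewrite -{2}(negK x); apply: le_joinl.
have -> : ¬ (x ⊕ w) ⊕ (y ⊕ w) = y ⊕ (¬ (x ⊕ w) ⊕ w).
  by rewrite oplusA (oplusC _ y) -oplusA.
have e : ¬ (¬ x ⊕ y) ⊕ (y ⊕ ¬ x) = ⊤ by rewrite (oplusC y) le_refl.
by apply: le1x; rewrite -{1}e; do 2!apply: le_oplus2l.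
Qed.

(** The element x ⊖ (x ⊖ y) is the meet of x and y. *)
Lemma diff_diff x y : ¬ (¬ x ⊕ ¬ (¬ x ⊕ y)) = ¬ (¬ y ⊔ ¬ x).
Proof. by rewrite (oplusC (¬ x) (¬ _)) negK (oplusC y). Qed.

Lemma diff_diff_add x y : ¬ (¬ x ⊕ ¬ (¬ x ⊕ y)) ⊕ ¬ (¬ x ⊕ y) = x.
Proof.
rewrite joinC join_idPr //.
by rewrite -{2}(negK x); apply/le_neg/le_oplusl.
Qed.

(** With m the meet of x and y one has x = m ⊕ (x ⊖ y) and y = m ⊕ (y ⊖ x), so
    adding to m a common lower bound s of both differences stays below m. *)
Lemma prelinear x y s : s ⊑ ¬ (¬ x ⊕ y) -> s ⊑ ¬ (¬ y ⊕ x) -> s = ⊥.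
Proof.
move=> sxy syx.
pose m := ¬ (¬ x ⊕ ¬ (¬ x ⊕ y)).
have mE : m = ¬ (¬ y ⊕ ¬ (¬ y ⊕ x)) by rewrite diff_diff joinC -diff_diff.
have msx : m ⊕ s ⊑ x by have := le_oplus2l m sxy; rewrite diff_diff_add.
have msy : m ⊕ s ⊑ y by have := le_oplus2l m syx; rewrite {2}mE diff_diff_add.
have ms : m ⊕ s ⊑ m.
  rewrite {2}/m diff_diff -contrapositive negK.
  by apply: join_lub; apply: le_neg.
(* This is what allows cancelling m in m ⊕ s = m: it gives ¬s = m ⊔ ¬s = ¬(m ⊕ s) ⊕ m = ¬m ⊕ m =
   1. *)
have sm : m ⊑ ¬ s.
  rewrite -contrapositive negK; apply: (le_trans sxy).
  by rewrite /m (negK (_ ⊕ ¬ _)); apply: le_oplusr.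
have nE : ¬ (m ⊕ s) = ¬ m by congr (¬ _); apply: le_anti ms (le_oplusl m s).
rewrite -(negK s) -(join_idPr sm) joinC negK (oplusC s) nE le_refl.
exact: negK.
Qed.

(** * Multiples and disjoint elements *)

Lemma amulS k x : amul k.+1 x = amul k x ⊕ x. Proof. by []. Qed.

Lemma amulD k l x : amul (k + l) x = amul k x ⊕ amul l x.
Proof.
by elim: l => [|l IH]; rewrite ?addn0 ?oplusx0 // addnS !amulS IH oplusA.
Qed.

Lemma amul0 k : amul k (⊥ : A) = ⊥.
Proof. by elim: k => //= k ->; rewrite oplusx0. Qed.

Lemma le_amul k l x : k <= l -> amul k x ⊑ amul l x.
Proof. by move=> /subnKC <-; rewrite amulD; apply: le_oplusl. Qed.

Definition disjoint_elts a b := forall s, s ⊑ a -> s ⊑ b -> s = ⊥.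

Lemma disjoint_eltsC a b : disjoint_elts a b -> disjoint_elts b a.
Proof. by move=> ab s sb sa; apply: ab. Qed.

(** If s lies below a and (k+1)b, then s ⊖ kb lies below a and b, hence is 0, so s already lies
    below kb. *)
Lemma disjoint_amul a b k : disjoint_elts a b -> disjoint_elts a (amul k b).
Proof.
move=> ab; elim: k => [|k IH] s sa; first exact: lex0.
rewrite amulS => skb; suff s1 : s ⊙ ¬ amul k b = ⊥.
  by apply: IH => //; rewrite -(negK (_ ⊕ _)) -(negK (amul k b)) s1.
apply: ab; first by apply: le_trans sa; apply: le_odotl.
by rewrite residuation negK.
Qed.

(** * Filters and prime filters *)

Record is_filter (F : A -> Prop) : Prop := IsFilter {
  filter1 : F ⊤;
  filter_le : forall x y, F x -> x ⊑ y -> F y;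
  filterM : forall x y, F x -> F y -> F (x ⊙ y) }.

(** For a filter [F] this is the filter generated by [F] and [u]: k(¬u) is the negation of the
    k-fold ⊙-power of u. *)
Definition adjoin (F : A -> Prop) u a := exists k, F (amul k (¬ u) ⊕ a).

Lemma oplus_odot p a s : (p ⊕ a) ⊙ s ⊑ p ⊕ a ⊙ s.
Proof.
rewrite residuation (oplusA (¬ s)) (oplusC (¬ s)) -oplusA; apply: le_oplus2l.
by rewrite -residuation le_refl.
Qed.

Lemma adjoin_filter F u : is_filter F -> is_filter (adjoin F u).
Proof.
move=> [F1 Fle FM]; split.
- by exists 0; rewrite oplusx1.
- by move=> x y [k Fk] xy; exists k; apply: Fle Fk _; apply: le_oplus2l.
move=> x y [k Fx] [l Fy]; exists (k + l); apply: Fle (FM _ _ Fx Fy) _.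
apply: (le_trans (oplus_odot _ _ _)); rewrite amulD -oplusA.
by apply: le_oplus2l; rewrite !(odotC x); apply: oplus_odot.
Qed.

(** The maximal filters avoiding [c] are prime, by prelinearity. *)
Lemma prime_filter c : c <> ⊤ -> exists F, [/\ is_filter F, ~ F c &
  forall x y, F (x ⇒ y) \/ F (y ⇒ x)].
Proof.
move=> c1.
(* Membership of ⊤ is left out because the union of the empty chain is empty; maximality restores it
   below. *)
pose P (X : set A) := [/\ forall x y, X x -> x ⊑ y -> X y,
  forall x y, X x -> X y -> X (x ⊙ y) & ~ X c].
have [C CP Ctot|F [[Fle FM Fc] Fmax]] := @Zorn_bigcup _ P.
  split=> [x y [X CX Xx] xy|x y [X CX Xx] [Y CY Yy]|[X CX]].
  - by exists X => //; case: (CP _ CX) => Xle _ _; apply: Xle xy.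
  - case: (Ctot _ _ CX CY) => XY; [exists Y|exists X] => //.
      by case: (CP _ CY) => _ + _; apply => //; apply: XY.
    by case: (CP _ CX) => _ + _; apply => //; apply: XY.
  - by case: (CP _ CX).
have {}Fmax (G : set A) : P G -> (F `<=` G)%classic -> forall x, G x -> F x.
  move=> PG FG x Gx; apply: contrapT => Fx; apply: (Fmax G) => //.
  by split=> // /(_ x Gx).
have F1 : F ⊤.
  apply: (Fmax [set x | F x \/ x = ⊤]%classic) => [| x|]; [|by left|by right].
  split=> [x y [Fx|->] xy|x y [Fx|->] [Fy|->]|[]//].
  - by left; apply: Fle xy.
  - by right; apply: le1x.
  - by left; apply: FM.
  - by left; rewrite negK oplusx0 negK.
  - by left; rewrite negK oplus0x negK.
  - by right; rewrite odot_eq1.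
have Ffilter : is_filter F by [].
have adjc u : ~ F u -> adjoin F u c.
  move=> Fu; apply: contrapT => nc; apply: Fu.
  apply: (Fmax (adjoin F u)).
  - by case: (adjoin_filter u Ffilter).
  - by move=> x Fx; exists 0; rewrite oplus0x.
  - by exists 1; rewrite /= oplus0x le_refl.
exists F; split=> // x y; apply: contrapT => /not_orP[/adjc[k Fk] /adjc[l Fl]].
apply: Fc; apply: Fle (FM _ _ Fk Fl) _; set t := _ ⊙ _.
(* The difference t ⊖ c lies below a multiple of x ⊖ y and below a multiple of y ⊖ x, and these
   multiples are disjoint. *)
suff t0 : t ⊙ ¬ c = ⊥ by rewrite -(negK (¬ t ⊕ c)) -(negK c) t0.
have xy : disjoint_elts (¬ (x ⇒ y)) (¬ (y ⇒ x)) by move=> s; apply: prelinear.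
have /(disjoint_amul (k := k))/disjoint_eltsC kxy := disjoint_eltsC xy.
apply: (disjoint_amul (k := l) kxy).
  by rewrite residuation (negK c) (oplusC c); apply: le_odotl.
by rewrite residuation (negK c) (oplusC c) /t odotC; apply: le_odotl.
Qed.

End MVTheory.

(** * Homomorphisms and transfer of identities *)

Definition is_hom (A B : algebra) (f : A -> B) : Prop :=
  [/\ f ⊥ = ⊥, forall x, f (¬ x) = ¬ f x & forall x y, f (x ⊕ y) = f x ⊕ f y].

Lemma eval_hom (A B : algebra) (f : A -> B) v t :
  is_hom f -> f (eval v t) = eval (f \o v) t.
Proof. by case=> f0 fN fD; elim: t => //= [t <-|s <- t <-]. Qed.

Lemma sat_eq_surj (A B : algebra) (f : A -> B) e :
  is_hom f -> (forall b, exists a, f a = b) -> sat_eq A e -> sat_eq B e.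
Proof.
move=> fh fs Ae v; have [w fw] := choice (fun i => fs (v i)).
have -> : v = f \o w by apply: funext => i; rewrite /= fw.
by rewrite -!eval_hom // Ae.
Qed.

Lemma sat_eq_inj (A B : algebra) (f : A -> B) e :
  is_hom f -> injective f -> sat_eq B e -> sat_eq A e.
Proof. by move=> fh fi Be v; apply: fi; rewrite !eval_hom. Qed.

Lemma sat_eq_prod (A B : algebra) e :
  sat_eq A e -> sat_eq B e -> sat_eq (prod_alg A B) e.
Proof.
move=> Ae Be v.
have fh : is_hom (fst : prod_alg A B -> A) by [].
have sh : is_hom (snd : prod_alg A B -> B) by [].
by apply: injective_projections; rewrite !(eval_hom _ _ fh, eval_hom _ _ sh).
Qed.

(** Listing the axioms as identities lets them pass to homomorphic images and to every algebra
    satisfying the identities of ŁV_{q+1}. *)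
Definition mv_axioms : seq equation :=
  let x := Var 0 in let y := Var 1 in let w := Var 2 in
  [:: (Oplus x (Oplus y w), Oplus (Oplus x y) w); (Oplus x y, Oplus y x);
      (Oplus x Zero, x); (Neg (Neg x), x); (Oplus x One, One);
      (Join x y, Join y x)].

Lemma is_MV_axioms A : is_MV A <-> forall e, List.In e mv_axioms -> sat_eq A e.
Proof.
split=> [[oA [oC [o0 [nK [o1 jC]]]]] e|H].
  by do 6!case=> [<- v //=|//].
have {}H e (x y w : A) : List.In e mv_axioms ->
    eval (nth w [:: x; y]) e.1 = eval (nth w [:: x; y]) e.2 by move=> /H; apply.
pose r := @or_intror.
split; first by move=> x y w; apply: (H _ x y w (or_introl erefl)).
split; first by move=> x y; apply: (H _ x y x (r _ _ (or_introl erefl))).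
split; first by move=> x; apply: (H _ x x x (r _ _ (r _ _ (or_introl erefl)))).
split.
  by move=> x; apply: (H _ x x x (r _ _ (r _ _ (r _ _ (or_introl erefl))))).
split=> [x|x y].
  by apply: (H _ x x x (r _ _ (r _ _ (r _ _ (r _ _ (or_introl erefl)))))).
by apply: (H _ x y x (r _ _ (r _ _ (r _ _ (r _ _ (r _ _ (or_introl erefl))))))).
Qed.

Lemma is_MV_surj (A B : algebra) (f : A -> B) :
  is_hom f -> (forall b, exists a, f a = b) -> is_MV A -> is_MV B.
Proof.
move=> fh fs /is_MV_axioms MA; apply/is_MV_axioms => e /MA.
exact: (sat_eq_surj fh fs).
Qed.

Definition Imp s t := Oplus (Neg s) t.
Definition Odot s t := Neg (Oplus (Neg s) (Neg t)).
Definition Equiv s t := Odot (Imp s t) (Imp t s).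

(** [nmul] starts from t and [amul] from ⊥, so they agree by 0 ⊕ x = x. *)
Lemma eval_nmul (A : algebra) (v : nat -> A) k t :
  is_MV A -> eval v (nmul k t) = amul k (eval v t).
Proof.
by move=> MA; elim: k => [|[|k]] //= IH; rewrite ?oplus0x // IH.
Qed.

Lemma eval_Odot (A : algebra) (v : nat -> A) s t :
  eval v (Odot s t) = eval v s ⊙ eval v t.
Proof. by []. Qed.

Lemma eval_Equiv1 (A : algebra) (v : nat -> A) s t : is_MV A ->
  eval v (Equiv s t) = ⊤ <-> eval v s = eval v t.
Proof. by move=> MA; apply: equiv_eq1. Qed.

(** * Quotient by a filter and reduction to chains *)

Section Quotient.
Variables (A : algebra) (F : A -> Prop).
Hypotheses (MV : is_MV A) (FF : is_filter F).

Definition filter_rel x y := F (x ⇒ y) /\ F (y ⇒ x).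

(** Classes are predicates, so congruent elements have equal classes by extensionality. *)
Definition quotient_type := {X : A -> Prop | exists x, X = filter_rel x}.

Definition class x : quotient_type := exist _ (filter_rel x) (ex_intro _ x erefl).

Definition repr (X : quotient_type) : A := projT1 (cid (svalP X)).

Lemma reprK X : class (repr X) = X.
Proof.
by case: X => X XE; apply: eq_exist; rewrite /repr; case: cid => x /= <-.
Qed.

Definition quotient : algebra :=
  @Algebra quotient_type (fun X Y => class (repr X ⊕ repr Y))
    (fun X => class (¬ repr X)) (class ⊥).

Lemma filter_rel_refl x : filter_rel x x.
Proof. by rewrite /filter_rel le_refl //; split; apply: (filter1 FF). Qed.

Lemma filter_rel_sym x y : filter_rel x y -> filter_rel y x.
Proof. by case. Qed.

Lemma filter_imp_trans x y w : F (x ⇒ y) -> F (y ⇒ w) -> F (x ⇒ w).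
Proof.
move=> xy yw; apply: (filter_le FF (filterM FF yw xy)).
rewrite residuation // !(oplusC MV (¬ x)).
exact: imp_oplus2r.
Qed.

Lemma filter_rel_trans x y w :
  filter_rel x y -> filter_rel y w -> filter_rel x w.
Proof.
move=> [xy yx] [yw wy].
by split; [apply: filter_imp_trans xy yw|apply: filter_imp_trans wy yx].
Qed.

Lemma class_eq x y : class x = class y <-> filter_rel x y.
Proof.
split=> [[xy]|xy]; first by rewrite xy; apply: filter_rel_refl.
apply: eq_exist => /=; apply: funext => w; apply: propext.
by split; apply: filter_rel_trans => //; apply: filter_rel_sym.
Qed.

Lemma filter_rel_repr x : filter_rel (repr (class x)) x.
Proof. by rewrite -class_eq reprK. Qed.

Lemma filter_rel_oplus2r w x y : filter_rel x y -> filter_rel (x ⊕ w) (y ⊕ w).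
Proof. by case=> xy yx; split; apply: filter_le (imp_oplus2r MV _ _ _). Qed.

Lemma class_hom : is_hom (class : A -> quotient).
Proof.
split=> // [x|x y]; apply/class_eq.
  have [xr rx] := filter_rel_repr x.
  by split; rewrite contrapositive.
apply: (@filter_rel_trans _ (x ⊕ repr (class y))).
  rewrite !(oplusC MV x); apply: filter_rel_oplus2r.
  exact: filter_rel_sym (filter_rel_repr y).
by apply: filter_rel_oplus2r; apply: filter_rel_sym (filter_rel_repr x).
Qed.

Lemma class_surj (X : quotient) : exists x, class x = X.
Proof. by exists (repr X); apply: reprK. Qed.

Lemma quotient_MV : is_MV quotient.
Proof. exact: is_MV_surj class_hom class_surj MV. Qed.

Lemma class_eq1 x : (class x : quotient) = ⊤ <-> F x.
Proof.
have [h0 hN _] := class_hom; rewrite -h0 -hN class_eq /filter_rel.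
rewrite oplusx1 // imp1x //.
by split=> [[]|Fx] //; split=> //; apply: (filter1 FF).
Qed.

Lemma class_imp x y : F (x ⇒ y) -> (class x : quotient) ⊑ (class y : quotient).
Proof. by have [_ hN hD] := class_hom; rewrite -hN -hD class_eq1. Qed.

End Quotient.

(** The equational consequence of Chang's representation theorem. *)
Lemma sat_eq_chains A e : is_MV A ->
  (forall C, is_MV C -> (forall x y : C, x ⊑ y \/ y ⊑ x) ->
     (forall e', sat_eq A e' -> sat_eq C e') -> sat_eq C e) ->
  sat_eq A e.
Proof.
move=> MA H v; apply: contrapT => /= ne.
set a := eval v e.1 in ne; set b := eval v e.2 in ne.
have c1 : (a ⇒ b) ⊙ (b ⇒ a) <> ⊤ by move=> /(equiv_eq1 MA).
have [F [FF Fc Ftot]] := prime_filter MA c1.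
have hom := class_hom MA FF; have surj := @class_surj A F.
(* The filter contains the biconditional of a and b exactly when they agree in the quotient, a chain
   because the filter is prime. *)
apply: Fc; rewrite -(class_eq1 MA FF).
have MC := quotient_MV MA FF.
have [_ hN hD] := hom; rewrite !(hN, hD) (equiv_eq1 MC) /a /b.
rewrite !(eval_hom _ _ hom); apply: H => //.
- move=> X Y; have [x <-] := surj X; have [y <-] := surj Y.
  by case: (Ftot x y) => xy; [left|right]; apply: class_imp.
- by move=> e'; apply: sat_eq_surj hom surj.
Qed.

(** * The finite chains *)

Section LV.
Variable q : nat.
Implicit Types x y : LV q.

Definition lv_val x : nat := nat_of_ord (x : 'I_q.+1).

Lemma lv_inj : injective lv_val. Proof. exact: ord_inj. Qed.

Lemma lv_le x : lv_val x <= q. Proof. by rewrite -ltnS; apply: ltn_ord. Qed.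

Lemma lv_oplus x y : lv_val (x ⊕ y) = minn q (lv_val x + lv_val y).
Proof. by rewrite /lv_val inordK // ltnS geq_minl. Qed.

Lemma lv_neg x : lv_val (¬ x) = q - lv_val x.
Proof. by rewrite /lv_val inordK // ltnS leq_subr. Qed.

Lemma lv_zero : lv_val ⊥ = 0. Proof. by rewrite /lv_val inordK. Qed.

Lemma lv_one : lv_val ⊤ = q. Proof. by rewrite lv_neg lv_zero subn0. Qed.

Definition lvE := (lv_neg, lv_oplus, lv_zero).

Lemma lv_amul k x : lv_val (amul k x) = minn q (k * lv_val x).
Proof. by elim: k => [|k IH]; rewrite /= !lvE ?IH; lia. Qed.

Lemma lv_MV : is_MV (LV q).
Proof.
split=> [x y w|]; [|split=> [x y|]]; [| |split=> [x|]];
  [| | |split=> [x|]]; [| | | |split=> [x|x y]].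
all: apply: lv_inj; rewrite !lvE; try have := lv_le x; try have := lv_le y; lia.
Qed.

(** A nonzero element is at least 1/q. This is how an implication between equations becomes an
    identity. *)
Lemma lv_amul_eq1 x : x <> ⊥ -> amul q x = ⊤.
Proof.
move=> x0; apply: lv_inj; rewrite lv_amul lv_one; apply/minn_idPl.
have : lv_val x <> 0 by move=> xv; apply: x0; apply: lv_inj; rewrite lv_zero.
nia.
Qed.

End LV.

(** [(q - 1) g = ¬ g] says that [g] is 1/q. *)
Lemma LV_hom q (A : algebra) (g : A) : is_MV A -> 0 < q ->
  amul q.-1 g = ¬ g -> is_hom (fun x : LV q => amul (lv_val x) g).
Proof.
move=> MA q0 gE.
have q1 : amul q g = ⊤ by rewrite -(prednK q0) amulS gE le_refl.
have big k : q <= k -> amul k g = ⊤.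
  by move=> qk; apply: (le1x MA); rewrite -{1}q1; apply: le_amul.
split=> [|x|x y]; first by rewrite lv_zero.
  rewrite lv_neg; have := lv_le x; elim: (lv_val x) => [|k IH] kq.
    by rewrite subn0 q1.
  have sE : q - k = (q - k.+1).+1 by lia.
  move: IH; rewrite sE !amulS => /(_ (ltnW kq)) IH.
  set s := amul _ _ in IH *.
  (* Below ¬g the summand g cancels, so s ⊕ g = ¬(kg) can be solved as s = ¬(kg ⊕ g). *)
  have sg : s ⊑ ¬ g by rewrite -gE; apply: le_amul => //; lia.
  rewrite -(negK MA (amul k g)) -IH -{1}(negK MA s); congr (¬ _).
  rewrite -{1}(join_idPr MA (_ : g ⊑ ¬ s)); last by rewrite -contrapositive // negK.
  by rewrite joinC // negK.
rewrite lv_oplus -amulD //.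
by case: (leqP q (lv_val x + lv_val y)) => // qk; rewrite (big _ qk) big.
Qed.

Definition lv1_bool (A : algebra) (x : LV 1) : A := amul (lv_val x) ⊤.

(** The case q = 1, g = ⊤ of [LV_hom]. *)
Lemma lv1_bool_hom A : is_MV A -> is_hom (@lv1_bool A).
Proof. by move=> MA; apply: LV_hom; rewrite //= negK. Qed.

Lemma sat_eq_LV1 q e : 0 < q -> sat_eq (LV q) e -> sat_eq (LV 1) e.
Proof.
move=> q0; apply: (sat_eq_inj (lv1_bool_hom (lv_MV q))) => x y.
move/(congr1 (@lv_val q)); rewrite !lv_amul lv_one => xy; apply: lv_inj.
by have := lv_le x; have := lv_le y; nia.
Qed.

(** * The identity and the chains satisfying it *)

Definition bigJoin (I : Type) (r : seq I) (F : I -> term) : term :=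
  foldr (fun i => Join (F i)) Zero r.

Definition coordinate q i (t : term) : term :=
  Odot (Equiv (nmul q.-1 t) (Neg t)) (Equiv (nmul i t) (Var 0)).

(** In a chain a join of two elements is ⊤ only if one of them is, so one identity can express a
    disjunction. *)
Definition chain_eq q (g : nat -> term) : equation :=
  (Join (Join (Var 0) (Neg (Var 0)))
        (bigJoin (iota 1 q.-1) (fun i => coordinate q i (g i))), One).

Lemma eval_coordinate (A : algebra) (v : nat -> A) q i t : is_MV A ->
  eval v (coordinate q i t) = ⊤ <->
  amul q.-1 (eval v t) = ¬ eval v t /\ amul i (eval v t) = v 0.
Proof.
move=> MA; rewrite /coordinate eval_Odot odot_eq1 // !eval_Equiv1 //.
by rewrite !eval_nmul.
Qed.

Section Chain.
Variable C : algebra.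
Hypotheses (MC : is_MV C) (tot : forall x y : C, x ⊑ y \/ y ⊑ x).

Lemma chain_join1 (x y : C) : x ⊔ y = ⊤ -> x = ⊤ \/ y = ⊤.
Proof.
case: (tot x y) => /(join_idPr MC) xy; first by rewrite xy; right.
by rewrite joinC // xy; left.
Qed.

Lemma chain_bigJoin (I : eqType) (v : nat -> C) (r : seq I) F : (⊥ : C) <> ⊤ ->
  eval v (bigJoin r F) = ⊤ -> exists2 i, i \in r & eval v (F i) = ⊤.
Proof.
move=> nt; elim: r => [//|i r IH] /= /chain_join1[t1|/IH[j jr j1]].
  by exists i; rewrite ?mem_head.
by exists j; rewrite // inE jr orbT.
Qed.

(** Enlarging g enlarges qg but shrinks ¬g. It is applied with q - 1 in place of q. *)
Lemma chain_generator_unique q (g h : C) :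
  amul q g = ¬ g -> amul q h = ¬ h -> g = h.
Proof.
move=> gE hE.
have mono k (x y : C) : x ⊑ y -> amul k x ⊑ amul k y.
  move=> xy; elim: k => [|k IH]; first exact: le0x.
  by apply: (le_trans MC (le_oplus2r MC _ IH)); apply: le_oplus2l.
have aux (x y : C) : amul q x = ¬ x -> amul q y = ¬ y -> x ⊑ y -> x = y.
  move=> xE yE xy; apply: le_anti => //.
  by rewrite -contrapositive // -xE -yE; apply: mono.
by case: (tot g h) => [/aux|/aux/esym]; apply.
Qed.

Lemma chain_image q t : 1 < q -> sat_eq C (chain_eq q t) -> forall e,
  sat_eq (LV q) e -> sat_eq C e.
Proof.
move=> q1 H e qe.
(* In the trivial algebra even the empty join is ⊤, so it is treated apart. *)
have [triv|nt] := pselect ((⊥ : C) = ⊤).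
  have tr (x : C) : x = ⊥ by rewrite -(oplusx0 MC x) {1}triv oplusx1.
  by move=> v; rewrite (tr (eval v e.1)) (tr (eval v e.2)).
have cases (x : C) : [\/ x = ⊥, x = ⊤ |
    exists g i, [/\ i < q, amul q.-1 g = ¬ g & amul i g = x]].
  have /chain_join1[/chain_join1[->|x0]|] := H (fun=> x).
  - by constructor 2.
  - by constructor 1; rewrite -(negK MC x) x0 negK.
  move/(chain_bigJoin nt) => [i].
  rewrite mem_iota => iq /(eval_coordinate _ _ _ _ MC)[gE gx].
  constructor 3; exists (eval (fun=> x) (t i)), i; split=> //; lia.
(* If such a g exists, every element is a multiple of it and C is an image of ŁV_{q+1}; otherwise
   only 0 and 1 remain and C is an image of ŁV_2. *)
have [[g gE]|ng] := pselect (exists g : C, amul q.-1 g = ¬ g).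
  apply: sat_eq_surj (LV_hom MC (ltnW q1) gE) _ qe => x.
  have q1g : amul q g = ⊤ by rewrite -(prednK (ltnW q1)) amulS gE le_refl.
  suff [i iq <-] : exists2 i, i <= q & amul i g = x.
    by exists (inord i : LV q); rewrite /lv_val inordK.
  case: (cases x) => [->|->|[h [i [iq hE <-]]]]; [by exists 0|by exists q|].
  by rewrite -(chain_generator_unique gE hE); exists i; first exact: ltnW.
apply: sat_eq_surj (lv1_bool_hom MC) _ (sat_eq_LV1 (ltnW q1) qe) => x.
case: (cases x) => [->|->|[g [i [_ gE _]]]]; last by case: ng; exists g.
  by exists ⊥; rewrite /lv1_bool lv_zero.
by exists ⊤; rewrite /lv1_bool lv_one /= oplus0x.
Qed.

End Chain.

Lemma join1x (A : algebra) (x y : A) : is_MV A -> x = ⊤ \/ y = ⊤ -> x ⊔ y = ⊤.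
Proof.
move=> MA [->|->]; last by rewrite oplusx1.
by rewrite joinC // oplusx1.
Qed.

Lemma bigJoin1 (A : algebra) (I : eqType) (v : nat -> A) (r : seq I) F i :
  is_MV A -> i \in r -> eval v (F i) = ⊤ -> eval v (bigJoin r F) = ⊤.
Proof.
move=> MA; elim: r => //= j r IH; rewrite inE => /predU1P[<-|/IH{}IH] i1.
  by apply: join1x => //; left.
by apply: join1x => //; right; apply: IH.
Qed.

(** * Unary terms and validity of the identity in ŁV_{q+1} *)

Fixpoint vars (t : term) : seq nat :=
  match t with
  | Var i => [:: i]
  | Zero => [::]
  | Neg s => vars s
  | Oplus s u => vars s ++ vars u
  end.

Lemma eq_eval (A : algebra) (v w : nat -> A) t :
  (forall i, i \in vars t -> v i = w i) -> eval v t = eval w t.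
Proof.
elim: t => [i|//|s IH|s IHs u IHu] /= vw.
- by apply: vw; rewrite inE.
- by rewrite IH.
by rewrite IHs ?IHu // => i ii; apply: vw; rewrite mem_cat ii ?orbT.
Qed.

Lemma only_varE k t : only_var k t = all (pred1 k) (vars t).
Proof. by elim: t => //= [i|s -> u ->]; rewrite ?andbT ?all_cat. Qed.

Lemma eval_only_var (A : algebra) (v : nat -> A) k t :
  only_var k t -> eval v t = eval (fun=> v k) t.
Proof.
by rewrite only_varE => /allP tk; apply: eq_eval => i /tk /eqP ->.
Qed.

Lemma only_var_nmul k n t : only_var k t -> only_var k (nmul n t).
Proof. by move=> tk; elim: n => [|[|n]] //= ->. Qed.

Lemma only_var_bigJoin (I : Type) k (r : seq I) F :
  (forall i, only_var k (F i)) -> only_var k (bigJoin r F).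
Proof. by move=> kF; elim: r => //= i r ->; rewrite kF. Qed.

(** The least positive j such that j/q is the value at x of a unary term divides
    q, because the remainder of q by j is such a value as well. *)
Lemma unit_term q (x : LV q) : prime q -> 0 < lv_val x < q ->
  exists2 t, only_var 0 t & lv_val (eval (fun=> x) t) = 1.
Proof.
move=> pq /andP[x0 xq].
pose S j := 0 < j /\ exists2 t, only_var 0 t & lv_val (eval (fun=> x) t) = j.
have Sx : exists j, `[< S j >].
  by exists (lv_val x); apply/asboolP; split=> //; exists (Var 0).
case: (ex_minnP Sx) => j /asboolP[j0 [t t0 tj]] jmin.
(* As x < q, this excludes j = q at the end, where primality leaves j = 1 or j = q. *)
have jx : j <= lv_val x by apply/jmin/asboolP; split=> //; exists (Var 0).
have rE : lv_val (eval (fun=> x) (Neg (nmul (q %/ j) t))) = q %% j.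
  rewrite /= lv_neg (eval_nmul _ _ _ (lv_MV q)) lv_amul tj.
  by rewrite (minn_idPr (leq_divM _ _)) {1}(divn_eq q j) addKn.
have jq : j %| q.
  rewrite /dvdn -leqn0 leqNgt; apply/negP => r0.
  have := ltn_pmod q j0; rewrite ltnNge => /negP; apply.
  apply/jmin/asboolP; split=> //; exists (Neg (nmul (q %/ j) t)) => //.
  exact: only_var_nmul.
have /orP[/eqP j1|/eqP jE] : (j == 1) || (j == q) by apply: (primeP pq).2.
  by exists t; rewrite // tj.
by move: jx; rewrite jE leqNgt xq.
Qed.

Lemma chain_eq_LV q : prime q ->
  exists t, one_var (chain_eq q t) /\ sat_eq (LV q) (chain_eq q t).
Proof.
move=> pq; have q1 := prime_gt1 pq.
have /choice[t tP] i : exists t, only_var 0 t /\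
    (0 < i < q -> lv_val (eval (fun=> inord i : LV q) t) = 1).
  (* [Zero] is the default outside the range, so that every [t i] is a term in variable 0. *)
  have [iq|_] := boolP (0 < i < q); last by exists Zero.
  have iE : lv_val (inord i : LV q) = i by rewrite /lv_val inordK //; lia.
  have [|t t0 t1] := @unit_term q (inord i) pq; first by rewrite iE.
  by exists t.
exists t; split.
  exists 0; rewrite /= andbT only_var_bigJoin // => i.
  have [ti _] := tP i.
  by rewrite /= ti !only_var_nmul.
move=> v; have MQ := lv_MV q.
apply: join1x => //.
have := lv_le (v 0); rewrite leq_eqVlt => /orP[/eqP vq|vq].
  by left; apply: join1x => //; left; apply: lv_inj; rewrite lv_one.
have [v0|v0] := posnP (lv_val (v 0)).
  left; apply: join1x => //; right; apply: lv_inj.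
  by rewrite /= lv_neg v0 lv_one subn0.
right; pose i := lv_val (v 0).
have [ti /(_ _)] := tP i; rewrite v0 vq /= => /(_ isT) ti1.
have vi : inord i = v 0 by apply: lv_inj; rewrite /lv_val inordK // ltnS lv_le.
rewrite vi in ti1.
apply: (bigJoin1 (i := i) MQ).
  by rewrite mem_iota add1n prednK ?(prime_gt0 pq) // /i v0.
rewrite eval_coordinate // (eval_only_var _ ti).
split; apply: lv_inj; rewrite lv_amul ?lv_neg ti1 ?muln1; first lia.
by apply/minn_idPr; apply: lv_le.
Qed.

(** * Reducing quasi-identities of the product to identities of ŁV_{q+1} *)

Definition premises (es : seq equation) : term :=
  foldr (fun e t => Odot (Equiv e.1 e.2) t) One es.

Lemma eval_premises (A : algebra) (v : nat -> A) es : is_MV A ->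
  eval v (premises es) = ⊤ <->
  forall e, List.In e es -> eval v e.1 = eval v e.2.
Proof.
move=> MA; elim: es => [|e es IH]; first by split.
rewrite -[premises _]/(Odot (Equiv e.1 e.2) (premises es)) eval_Odot.
rewrite odot_eq1 // IH eval_Equiv1 //.
split=> [[e12 H] e' [<-|/H]//|H].
by split=> [|e' e'i]; apply: H; [left|right].
Qed.

(** In ŁV_{q+1} it measures the distance from a Boolean valuation: it is 0 exactly when all listed
    variables take values in {0, 1}. *)
Definition boundary (r : seq nat) : term :=
  bigJoin r (fun i => Meet (Var i) (Neg (Var i))).

Section Boundary.
Variable q : nat.

Lemma lv_join (x y : LV q) : lv_val (x ⊔ y) = maxn (lv_val x) (lv_val y).
Proof. by rewrite !lvE; have := lv_le x; have := lv_le y; lia. Qed.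

Lemma lv_meet (v : nat -> LV q) s t :
  lv_val (eval v (Meet s t)) = minn (lv_val (eval v s)) (lv_val (eval v t)).
Proof.
rewrite /= !lvE; have := lv_le (eval v s); have := lv_le (eval v t); lia.
Qed.

Lemma lv_boundary_cons (v : nat -> LV q) i r :
  lv_val (eval v (boundary (i :: r))) =
  maxn (minn (lv_val (v i)) (q - lv_val (v i))) (lv_val (eval v (boundary r))).
Proof.
rewrite (_ : eval v _ =
  eval v (Meet (Var i) (Neg (Var i))) ⊔ eval v (boundary r)) //.
by rewrite lv_join lv_meet [eval v (Neg _)]/= lv_neg.
Qed.

(** Each joinand is at most 1/2. Hence z ∧ ¬z = z for the boundary z, and it vanishes only with
    z. *)
Lemma lv_boundary_le (v : nat -> LV q) r :
  (lv_val (eval v (boundary r))).*2 <= q.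
Proof.
elim: r => [|i r IH]; first by rewrite lv_zero.
by rewrite lv_boundary_cons; have := lv_le (v i); lia.
Qed.

Lemma lv_boundary_ge (v : nat -> LV q) r i : i \in r ->
  minn (lv_val (v i)) (q - lv_val (v i)) <= lv_val (eval v (boundary r)).
Proof.
elim: r => [//|j r IH]; rewrite inE lv_boundary_cons leq_max.
by case/predU1P => [<-|/IH ->]; rewrite ?leqnn ?orbT.
Qed.

End Boundary.

Section Quasi.
Variables (q : nat) (A : algebra).
Hypotheses (q0 : 0 < q) (MA : is_MV A) (LA : in_V (LV q) A).

Lemma eval_prod (A1 A2 : algebra) (v : nat -> prod_alg A1 A2) t :
  eval v t = (eval (fst \o v) t, eval (snd \o v) t).
Proof. by elim: t => //= [i|s ->|s -> u ->] //; case: (v i). Qed.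

Lemma boolean_premises es (v : nat -> LV q) :
  (forall e, List.In e es -> eval v e.1 = eval v e.2) ->
  eval v (boundary (vars (premises es))) = ⊥ ->
  exists w : nat -> LV 1,
    forall e, List.In e es -> eval w e.1 = eval w e.2.
Proof.
move=> ves v0; have MQ := lv_MV q; have M1 := lv_MV 1.
(* On the variables of the premises v takes only the values 0 and 1, so there w agrees with v after
   embedding ŁV_2. *)
pose w i : LV 1 := if lv_val (v i) == 0 then ⊥ else ⊤.
exists w; apply/(eval_premises _ _ M1).
have hom := lv1_bool_hom MQ.
have inj : injective (@lv1_bool (LV q)).
  move=> x y /(congr1 (@lv_val q)); rewrite !lv_amul lv_one => xy; apply: lv_inj.
  by have := lv_le x; have := lv_le y; nia.
apply: inj; rewrite (eval_hom _ _ hom); have [h0 hN _] := hom; rewrite hN h0.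
move/(eval_premises _ _ MQ): ves => <-; apply: eq_eval => i /(lv_boundary_ge v).
rewrite v0 lv_zero /w /lv1_bool => vi; apply: lv_inj; rewrite lv_amul lv_one.
by have := lv_le (v i); case: eqP => vi0; rewrite ?lv_zero ?lv_one; nia.
Qed.

Lemma in_Q_of_qi : sat_qeq A (qi_q q) -> in_Q (prod_alg (LV q) (LV 1)) A.
Proof.
move=> Aq [es [s t]] BQ v vs.
have MQ := lv_MV q.
set p := premises es.
have vp : ¬ eval v p = ⊥ by rewrite (eval_premises v es MA).2 // negK.
(* Either ¬p is nonzero and q(¬p) = 1, or p = 1, the premises hold and c = 1. *)
have weaken c (u : nat -> LV q) :
    ((forall e, List.In e es -> eval u e.1 = eval u e.2) -> eval u c = ⊤) ->
    eval u (Oplus (nmul q (Neg p)) c) = ⊤.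
  move=> uc; rewrite /= eval_nmul //=.
  have [p0|/lv_amul_eq1 ->] := pselect ((¬ eval u p : LV q) = ⊥); last first.
    exact: (oplus1x MQ).
  rewrite uc; first exact: (oplusx1 MQ).
  by apply/(eval_premises _ _ MQ); rewrite -(negK MQ (eval u _)) p0.
have deduce c : (forall u : nat -> LV q,
     (forall e, List.In e es -> eval u e.1 = eval u e.2) -> eval u c = ⊤) ->
    eval v c = ⊤.
  move=> uc; have := LA (e := (Oplus (nmul q (Neg p)) c, One)).
  move=> /(_ (fun u => weaken c u (uc u)) v).
  by rewrite /= eval_nmul //= vp amul0 // oplus0x.
(* A Boolean solution w pairs with any solution u in ŁV_{q+1} to a solution in the product, so the
   conclusion holds at u. *)
have [[w wes]|nw] := pselect (exists w : nat -> LV 1,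
    forall e, List.In e es -> eval w e.1 = eval w e.2).
  apply/(eval_Equiv1 v s t MA); apply: deduce => u ues; apply/eval_Equiv1 => //.
  have /= := BQ (fun i => (u i, w i)); rewrite !eval_prod => H.
  suff [] : (eval u s, eval w s) = (eval u t, eval w t) by [].
  by apply: H => e ei; rewrite !eval_prod /= (ues _ ei) (wes _ ei).
(* Without a Boolean solution, z is nonzero at every solution in ŁV_{q+1}. *)
pose z := boundary (vars p); pose a := eval v z.
have qz : amul q (eval v (Meet z (Neg z))) = ⊤.
  rewrite -eval_nmul //; apply: deduce => u ues.
  rewrite eval_nmul // lv_amul_eq1 // => /(congr1 (@lv_val q)).
  rewrite lv_meet /= lv_neg lv_zero => z0; case: nw.
  apply: (boolean_premises ues); apply: lv_inj; rewrite lv_zero.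
  move: z0 (lv_boundary_le u (vars p)).
  rewrite -/p -/z; move: (lv_val (eval u z)) => k; lia.
have /= A2 y := Aq (fun i => if i == 0 then a else y).
have {A2} boolA (y : A) : y ⊔ ¬ y = ⊤.
  by apply: A2 => e [<-|//]; rewrite /= eval_nmul.
(* For y = a the excluded middle gives a ∧ ¬a = 0, against q(a ∧ ¬a) = 1. *)
have triv : (⊥ : A) = ⊤.
  by rewrite -qz -[eval v _]/(¬ (¬ a ⊔ ¬ ¬ a)) boolA negK // amul0.
have tr (x : A) : x = ⊥ by rewrite -(oplusx0 MA x) {1}triv oplusx1.
by rewrite /= (tr (eval v s)) (tr (eval v t)).
Qed.

End Quasi.

(** The premise is never met: in the factor ŁV_2 the element x ∧ ¬x is 0, and so are its
    multiples. *)
Lemma qi_holds q : 1 < q -> sat_qeq (prod_alg (LV q) (LV 1)) (qi_q q).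
Proof.
move=> q1 v /(_ _ (or_introl erefl)) /=; rewrite !eval_prod => -[_].
have M1 := lv_MV 1; set w := snd \o v.
rewrite (eval_nmul _ _ _ M1) => /(congr1 (@lv_val 1)).
rewrite lv_amul lv_meet /= lv_neg lv_one.
by have := lv_le (w 0); lia.
Qed.

Theorem theorem5p6 (q : nat) (hq : prime q) :
  (exists e : equation, one_var e /\ axiomatizes_V_rel_MV e (LV q)) /\
  (forall e : equation, one_var e -> axiomatizes_V_rel_MV e (LV q) ->
     forall A : algebra,
       in_Q (prod_alg (LV q) (LV 1)) A <->
       (is_MV A /\ sat_eq A e /\ sat_qeq A (qi_q q))).
Proof.
have q1 := prime_gt1 hq; have q0 := ltnW q1.
split.
  have [t [one_e eq_e]] := chain_eq_LV hq.
  exists (chain_eq q t); split=> // A MA; split=> [/(_ _ eq_e) //|Ae e qe].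
  apply: sat_eq_chains => // C MC tot eqC.
  by apply: (chain_image MC tot q1) qe; apply: eqC.
move=> e _ ax A; split=> [QA|[MA [Ae qA]]]; last first.
  by apply: in_Q_of_qi => //; apply/ax.
(* An identity is a quasi-identity without premises, and it passes from ŁV_{q+1} to its subalgebra
   ŁV_2 and so to the product. *)
have eqA e' : sat_eq (LV q) e' -> sat_eq A e'.
  move=> qe v; apply: (QA ([::], e')) => // {}v _.
  by apply: (sat_eq_prod qe); apply: sat_eq_LV1 qe.
split; last split.
- by apply/is_MV_axioms => e' /(is_MV_axioms _).1 H; apply/eqA/H/lv_MV.
- by apply: eqA; apply/(ax _ (lv_MV q)).
by apply: QA; apply: qi_holds.
Qed.
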